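(* Let $\mathbb{K}$ be a non-Archimedean valued field with valuation $|\cdot|$, and let $n\in\mathbb{N}$. The following two statements are equivalent. (i) For every $A=[a_{j,k}]_{1\leq j\leq n,\,1\leq k\leq n}\in\mathbb{M}_n(\mathbb{K})$, $$\sigma(A)\subseteq \bigcup_{j,k=1,\ j\neq k}^n\{z\in\mathbb{K}: |z-a_{j,j}|\,|z-a_{k,k}|\leq h_j(A)h_k(A)\}.$$ (ii) Every $B=[b_{j,k}]_{1\leq j\leq n,\,1\leq k\leq n}\in\mathbb{M}_n(\mathbb{K})$ that satisfies $$|b_{j,j}|\,|b_{k,k}|>h_j(B)h_k(B)\quad\text{for all } 1\leq j,k\leq n,\ j\neq k,$$ is invertible.
   Context: A non-Archimedean valued field is a field $\mathbb{K}$ with a map $|\cdot|:\mathbb{K}\to[0,\infty)$ such that $|x|=0$ iff $x=0$, $|xy|=|x||y|$, and $|x+y|\leq\max\{|x|,|y|\}$ for all $x,y\in\mathbb{K}$. $\mathbb{N}$ is the set of positive integers and $\mathbb{M}_n(\mathbb{K})$ denotes the $n\times n$ matrices over $\mathbb{K}$. $\sigma(A)$ is the set of all eigenvalues of $A$ in $\mathbb{K}$, i.e. the $\lambda\in\mathbb{K}$ with $A\mathbf{x}=\lambda\mathbf{x}$ for some nonzero $\mathbf{x}\in\mathbb{K}^n$. For $A=[a_{j,k}]\in\mathbb{M}_n(\mathbb{K})$ and $1\leq j\leq n$, define $h_j(A)=\max_{1\leq k\leq n,\,k\neq j}|a_{j,k}|$, where a maximum over the empty set (occurring only when $n=1$)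 is $0$. *)

(* Defs.v *)
From HB Require Import structures.
From mathcomp Require Import all_boot all_order all_algebra.
From mathcomp Require Import classical_sets reals.

Set Implicit Arguments.
Unset Strict Implicit.
Unset Printing Implicit Defensive.

Import Order.TTheory GRing.Theory Num.Theory.
Local Open Scope ring_scope.
Local Open Scope classical_set_scope.

Record nonarch_valuation (R : realType) (K : fieldType) := NonarchValuation {
  absv :> K -> R;
  absv_ge0 : forall x, 0 <= absv x;
  absv_eq0 : forall x, absv x = 0 <-> x = 0;
  absvM : forall x y, absv (x * y) = absv x * absv y;
  absv_ultra : forall x y, absv (x + y) <= Num.max (absv x) (absv y)
}.

(* Right eigenvalues (column eigenvectors); the library's [eigenvalue] uses
   row eigenvectors. *)
Definition spectrum (K : fieldType) (n : nat) (A : 'M[K]_n) : set K :=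
  [set lam | exists x : 'cV[K]_n, x != 0 /\ A *m x = lam *: x].

(* The default value 0 is harmless on nonempty ranges, since
   valuations are nonnegative, and gives the value 0 when [n = 1]. *)
Definition offdiag_max (R : realType) (K : fieldType)
    (v : nonarch_valuation R K) (n : nat) (A : 'M[K]_n) (j : 'I_n) : R :=
  \big[Num.max/0]_(k < n | k != j) v (A j k).

(* Main.v *)
Require Import Defs.
From mathcomp Require Import all_boot all_order all_algebra.
From mathcomp Require Import boolp classical_sets reals.

Set Implicit Arguments.
Unset Strict Implicit.
Unset Printing Implicit Defensive.

(** Both statements speak of the same matrices: [lam] is an eigenvalue of [A]
    exactly when [lam%:M - A] is singular, and this shift changes each diagonal
    entry into [lam - A j j] while only changing the sign of the others, so that
    it preserves every row maximum because [v (- x) = v x]. The condition in (ii)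
    for [lam%:M - A] is therefore the negation of the membership of [lam] in the
    union of (i).  From (ii) to (i), one shifts by the eigenvalue
    ([spectrum_shift], [offdiag_max_shift]); from (i) to (ii), one takes
    [lam = 0].  The argument is the same for [n = 1]: the union is then
    empty and the condition in (ii) vacuous, so both statements fail. *)

Import Order.TTheory GRing.Theory Num.Theory.
Local Open Scope ring_scope.
Local Open Scope classical_set_scope.

Lemma absvN (R : realType) (K : fieldType) (v : nonarch_valuation R K) (x : K) :
  v (- x) = v x.
Proof.
apply/eqP; rewrite -(@eqrXn2 _ 2) ?absv_ge0 //.
by rewrite !expr2 -!absvM mulrNN.
Qed.

(** The determinant criterion for singularity gives a row kernel vector, whereas
    the spectrum asks for a column vector; transposition relates the two. *)
Lemma spectrum_shift (K : fieldType) (n : nat) (A : 'M[K]_n) (lam : K) :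
  spectrum A lam <-> lam%:M - A \notin unitmx.
Proof.
rewrite unitmxE unitfE negbK -det_tr; split.
- move=> [x [x_neq0 Ax]]; apply/det0P; exists x^T.
    by rewrite trmx_eq0.
  by rewrite -trmx_mul mulmxBl mul_scalar_mx Ax subrr trmx0.
- case/det0P=> y y_neq0 yB0; exists y^T; split; first by rewrite trmx_eq0.
  apply/esym/eqP; rewrite -subr_eq0 -mul_scalar_mx -mulmxBl.
  by rewrite -[_ - A]trmxK -trmx_mul yB0 trmx0.
Qed.

Lemma offdiag_max_shift (R : realType) (K : fieldType)
    (v : nonarch_valuation R K) (n : nat) (A : 'M[K]_n) (lam : K) (j : 'I_n) :
  offdiag_max v (lam%:M - A) j = offdiag_max v A j.
Proof.
apply: eq_bigr => k k_neq_j.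
by rewrite !mxE eq_sym (negbTE k_neq_j) mulr0n sub0r absvN.
Qed.

Theorem theorem2p7 (R : realType) (K : fieldType)
    (v : nonarch_valuation R K) (n : nat) (n_gt0 : (0 < n)%N) :
  (forall A : 'M[K]_n,
     spectrum A `<=`
     \bigcup_(p in [set p : 'I_n * 'I_n | p.1 != p.2])
       [set z : K | v (z - A p.1 p.1) * v (z - A p.2 p.2)
                    <= offdiag_max v A p.1 * offdiag_max v A p.2])
  <->
  (forall B : 'M[K]_n,
     (forall j k : 'I_n, j != k ->
        v (B j j) * v (B k k) > offdiag_max v B j * offdiag_max v B k) ->
     B \in unitmx).
Proof.
split=> [incl B domB | inv A lam lamA].
- apply/negPn/negP => B_sing.
  (* Singularity survives negation, so 0 is an eigenvalue of B. *)
  have B0 : spectrum B 0.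
    by apply/spectrum_shift; rewrite raddf0 sub0r -scaleN1r unitmxZ ?unitrN1.
  have [[j k] /= jk] := incl B 0 B0.
  by rewrite !sub0r !absvN leNgt domB.
- apply: contrapT => lam_out.
  apply/negP: (proj1 (spectrum_shift A lam) lamA); rewrite negbK.
  apply: inv => j k jk; rewrite !offdiag_max_shift !mxE !eqxx !mulr1n ltNge.
  by apply/negP => le_jk; apply: lam_out; exists (j, k).
Qed.
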